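(* Let $X$ be a real stationary Gaussian process on $\mathbb{R}$ with reduced covariance function $C_X$. Assume that $X$ is almost surely of class $\mathcal{C}^1$ and that there is a sequence $t_n\to\infty$ such that $|C_X(t_n)|\to 1$. Then the zero set $Z_X=\{t\in\mathbb{R}:X(t)=0\}$ is completely predictable.
   Context: A real stationary Gaussian process $X$ is a (centered) random function on $\mathbb{R}$ with Gaussian finite-dimensional distributions and covariance $\mathrm{Cov}(X(t),X(s))=C_X(t-s)$; it is normalized so that $C_X(0)=1$. A point process on $\mathbb{R}$ is a random element $Z$ of the space of locally finite subsets of $\mathbb{R}$ with the $\sigma$-algebra generated by the counting maps $Z\mapsto\#(Z\cap A)$, $A$ Borel. For a Borel set $A$, $\sigma(Z\cap A)$ is the $\sigma$-algebra generated by the restriction $Z\cap A$. $Z$ is completely predictable if $$\sigma(Z)=\bigcap_{t\in\mathbb{R}}\sigma\bigl(Z\cap(-\infty,t)\bigr),$$ where all $\sigma$-algebras are understood as completed by the $\mathbf{P}$-null sets. *)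

(* Defs.v *)
From HB Require Import structures.
From mathcomp Require Import all_boot all_order all_algebra.
From mathcomp Require Import all_classical all_reals all_analysis.
From mathcomp Require Import measurable_realfun.

Set Implicit Arguments.
Unset Strict Implicit.
Unset Printing Implicit Defensive.

Import Order.TTheory GRing.Theory Num.Theory.
Import numFieldNormedType.Exports.

Local Open Scope classical_set_scope.
Local Open Scope ring_scope.

(* [normal_prob m 0] is the uniform law on [0, 1] by convention; the degenerate
   Gaussian law N(m, 0) has to be the Dirac mass at m. *)
Definition gaussian_law {R : realType} (m s : R) (A : set R) : \bar R :=
  if s == 0 then \d_m A else normal_prob m s A.

Definition gaussian_variable {d : measure_display} {T : measurableType d}
    {R : realType} (P : probability T R) (Y : T -> R) : Prop :=
  exists m s : R, forall A : set R, measurable A ->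
    pushforward P Y A = gaussian_law m s A.

(* A random vector is Gaussian when all the linear combinations of its
   coordinates are (possibly degenerate) Gaussian variables. *)
Definition gaussian_process {d : measure_display} {T : measurableType d}
    {R : realType} (P : probability T R) (X : R -> {RV P >-> R}) : Prop :=
  forall (n : nat) (t a : 'I_n -> R),
    gaussian_variable P (fun w => \sum_(i < n) a i * X (t i) w).

Definition stationary_gaussian_process {d : measure_display}
    {T : measurableType d} {R : realType} (P : probability T R)
    (X : R -> {RV P >-> R}) (C : R -> R) : Prop :=
  [/\ gaussian_process X,
      forall t : R, ('E_P[X t] = 0)%E,
      forall t s : R, covariance P (X t) (X s) = (C (t - s))%:E
    & C 0 = 1].

Definition class_C1 {R : realType} (f : R -> R) : Prop :=
  (forall t : R, derivable f t 1) /\ continuous (derive1 f).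

Definition zero_set {T : Type} {R : realType} (X : R -> T -> R) (w : T) :
    set R :=
  [set t | X t w = 0].

Definition locally_finite {R : realType} (A : set R) : Prop :=
  forall K : set R, compact K -> finite_set (K `&` A).

Definition completed {d : measure_display} {T : measurableType d}
    {R : realType} (P : probability T R) (G : set (set T)) : set (set T) :=
  <<s G `|` P.-negligible >>.

(* The counting maps take values in [0, +oo], with value +oo on infinite
   sets. *)
Definition sigma_counts {T : Type} {R : realType} (Z : T -> set R) :
    set (set T) :=
  <<s \bigcup_(B in measurable : set (set R))
        preimage_set_system setT
          (fun w => counting (Z w `&` B) : \bar R)
          measurable >>.

(* A random set need only be locally finite almost surely, and measurable with
   respect to the completion of the underlying sigma-algebra. *)
Definition point_process {d : measure_display} {T : measurableType d}
    {R : realType} (P : probability T R) (Z : T -> set R) : Prop :=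
  {ae P, forall w, locally_finite (Z w)} /\
  sigma_counts Z `<=` completed P measurable.

Definition completely_predictable {d : measure_display} {T : measurableType d}
    {R : realType} (P : probability T R) (Z : T -> set R) : Prop :=
  point_process P Z /\
  completed P (sigma_counts Z) =
  \bigcap_(t in [set: R])
    completed P (sigma_counts (fun w => Z w `&` `]-oo, t[)).

(* Main.v *)
Require Import Defs.
From HB Require Import structures.
From mathcomp Require Import all_boot all_order all_algebra finmap.
From mathcomp Require Import all_classical all_reals all_analysis.
From mathcomp Require Import measurable_realfun.
From mathcomp Require Import ring lra.

Import Order.TTheory GRing.Theory Num.Theory.
Import numFieldNormedType.Exports.

Local Open Scope classical_set_scope.
Local Open Scope ring_scope.

Set Implicit Arguments.
Unset Strict Implicit.
Unset Printing Implicit Defensive.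

(** The zero set and the signs of the products [X q * X r], for [q < r] rational,
    carry the same information as soon as all zeros of the path are simple.
    Indeed the sign of such a product is the parity of the number of zeros
    between [q] and [r] ([sign_change_odd]), and conversely an interval contains
    a zero if and only if some product with [q] and [r] inside it is negative
    ([zero_between_sign_change]); the events of hitting an interval determine
    all the counts ([measurable_counting_of_hits]).

    So it suffices that each event [X q * X r < 0] belongs, up to null sets, to
    the sigma-algebra of the zeros before any given time [t]. Along a sequence
    of times [u n] that grows to infinity fast enough, the correlation of [X q]
    and [X (q - u n)] tends to [1] in absolute value, so that [X (q - u n)] is
    close to [X q] or to [- X q], with a sign that depends on [n] but not on
    [q]. This sign disappears from the product at [q] and [r]. Since [X q] and
    [X r] are not too close to zero, the Borel-Cantelli lemma implies that almost
    surely the product at [q - u n] and [r - u n] finally has the same sign as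
    that at [q] and [r] ([sign_change_liminf]). For large [n] these points are
    before time [t], and the sign of the product there is a parity of a number
    of zeros before [t] ([past_sign_change]).

    That the zeros are simple is Bulinskaya's theorem ([double_zero_negligible]).
    It rests, like the Borel-Cantelli argument, on one property of the Gaussian
    law: the probability that [`|X t| <= e] is at most [4 * e] for all [t]
    ([gaussian_small_ball]). *)

(** * Counting the points of a locally finite set in an interval *)

Lemma finite_set_max (R : realType) (A : set R) :
  finite_set A -> A !=set0 -> exists2 z, A z & forall t, A t -> t <= z.
Proof.
move=> /finite_seqP[s ->{A}].
elim: s => [[x]//|x s IH _].
have [-> | s0] := eqVneq s [::].
  by exists x => /=; [rewrite inE | move=> t /=; rewrite inE => /eqP ->].
have [|z zs zmax] := IH.
  by case: s s0 {IH} => // y s _; exists y; rewrite /= inE eqxx.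
exists (Num.max x z) => [|t].
  by rewrite /= maxEle; case: ifP; rewrite inE ?zs ?orbT// eqxx.
by rewrite /= inE le_max => /orP[/eqP ->|/zmax ->]; rewrite ?lexx ?orbT.
Qed.

Definition points_between (R : realType) (Z : set R) (a b : R) : nat :=
  #|` fset_set (Z `&` `]a, b[)|.

Lemma locally_finite_oo (R : realType) (Z : set R) (a b : R) :
  locally_finite Z -> finite_set (Z `&` `]a, b[).
Proof.
move=> /(_ _ (@segment_compact _ a b)); apply: sub_finite_set => x [Zx].
by move=> /subset_itv_oo_cc abx; split.
Qed.

Lemma counting_oo (R : realType) (Z : set R) (a b : R) : locally_finite Z ->
  counting (Z `&` `]a, b[) = (points_between Z a b)%:R%:E :> \bar R.
Proof.
by move=> lfZ; rewrite /counting asboolT//; exact: locally_finite_oo.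
Qed.

(** Removing the last point [z] of [Z] in [`]a, b[] lowers the count by one: all
    windows [`]a, c[] with [c] just left of [z] contain the same remaining
    points. Every induction on the number of points peels off [z] in this
    way; keeping [c] free in an interval leaves room for choosing it rational,
    or at a place where a given function has a known sign. *)
Lemma points_between_last (R : realType) (Z : set R) (a b : R) :
  locally_finite Z -> Z `&` `]a, b[ !=set0 ->
  exists c0 z, [/\ a <= c0, c0 < z, z < b & Z z] /\
   [/\ forall t, z < t -> t < b -> ~ Z t
    & forall c, c0 < c -> c < z ->
     (points_between Z a c).+1 = points_between Z a b].
Proof.
move=> lfZ Zab0.
have fab := locally_finite_oo a b lfZ.
have [z [Zz]] := finite_set_max fab Zab0.
rewrite /= in_itv/= => /andP[az zb] zmax.
(* [c0] is the last but one point, or [a] when there is no other. *)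
have [c0 [ac0 c0z c0max]] : exists c0, [/\ a <= c0, c0 < z &
    forall t, Z t -> a < t -> t < z -> t <= c0].
  have [|no] := pselect (Z `&` `]a, z[ !=set0).
    move=> /(finite_set_max (locally_finite_oo a z lfZ))[c [Zc]].
    rewrite /= in_itv/= => /andP[ac cz] cmax; exists c; split => //.
      exact: ltW.
    by move=> t Zt a_t tz; apply: cmax; split => //=; rewrite in_itv/= a_t.
  exists a; split => // t Zt a_t tz; exfalso; apply: no; exists t.
  by split => //=; rewrite in_itv/= a_t.
exists c0, z; split=> //; split=> [t zt tb Zt|c c0c cz].
  have : t <= z by apply: zmax; split => //=; rewrite in_itv/= tb (lt_trans az).
  by rewrite leNgt zt.
have ac : a < c := le_lt_trans ac0 c0c.
rewrite /points_between.
have -> : Z `&` `]a, b[ = z |` (Z `&` `]a, c[).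
  rewrite predeqE => t; split => /=.
    rewrite in_itv/= => -[Zt /andP[a_t tb]].
    have := zmax t; rewrite /= in_itv/= a_t tb => /(_ (conj Zt isT)).
    rewrite le_eqVlt => /orP[/eqP ->|tz]; first by left.
    right; split => //; rewrite in_itv/= a_t/=.
    exact: le_lt_trans (c0max _ Zt a_t tz) c0c.
  rewrite !in_itv/= => -[->|[Zt /andP[a_t tc]]]; split => //.
    by rewrite az zb.
  by rewrite a_t (lt_trans tc)// (lt_trans cz).
have fac := locally_finite_oo a c lfZ.
rewrite fset_setU1// cardfsU1 (_ : z \notin _) ?add1n//.
rewrite in_fset_set// notin_setE /= in_itv/= => -[_ /andP[_ zc]].
by have := lt_trans cz zc; rewrite ltxx.
Qed.

(** * Zeros of a differentiable function with simple zeros *)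

Definition simple_zeros (R : realType) (f : R -> R) :=
  forall t, derivable f t 1 /\ (f t = 0 -> derive1 f t != 0).

Lemma simple_zeros_continuous (R : realType) (f : R -> R) :
  simple_zeros f -> continuous f.
Proof.
by move=> sf t; apply: differentiable_continuous; apply/derivable1_diffP/(sf t).1.
Qed.

Lemma difference_quotient_near (R : realType) (f : R -> R) (z : R) :
  derivable f z 1 -> f z = 0 -> forall e, 0 < e ->
  exists2 d, 0 < d & forall h, h != 0 -> `|h| < d ->
    `| f (z + h) / h - derive1 f z | < e.
Proof.
move=> df fz e e0.
have := df; rewrite /derivable => /cvg_ex[l /= hl].
have El : derive1 f z = l by rewrite derive1E /derive; exact: (cvg_lim _ hl).
move/cvgrPdist_lt : hl => /(_ e e0).
rewrite /dnbhs /within /= => -[d /= d0 hd].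
exists d => // h h0 hde.
have := hd h; rewrite /ball/= sub0r normrN => /(_ hde h0).
rewrite fz subr0 -[_ *: _]/(_ * _) [h%:A](_ : _ = h); last first.
  by rewrite -[LHS]/(h * 1) mulr1.
by rewrite El distrC [h + z]addrC [h^-1 * _]mulrC.
Qed.

(** The difference quotient at [z] has the sign of the derivative, so [f] has
    opposite signs on the two sides of [z]. *)
Lemma sign_near_simple_zero (R : realType) (f : R -> R) (z : R) :
  simple_zeros f -> f z = 0 ->
  exists2 e, 0 < e & forall h, h != 0 -> `|h| < e ->
    0 < derive1 f z * (h * f (z + h)).
Proof.
move=> sf fz; have [df /(_ fz) f'z] := sf z.
have [|e e0 he] := difference_quotient_near df fz (e := `|derive1 f z|).
  by rewrite normr_gt0.
exists e => // h h0 hhe; have := he h h0 hhe.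
set c := derive1 f z in f'z *; set q := f (z + h) / h => hq.
have -> : f (z + h) = q * h by rewrite /q divfK.
have h2 : 0 < h ^+ 2 by rewrite exprn_even_gt0.
rewrite [X in 0 < X](_ : _ = h ^+ 2 * (c * q)); last by ring.
apply: mulr_gt0 => //.
have : (q - c) ^+ 2 < c ^+ 2.
  by rewrite -(real_normK (num_real (q - c))) -(real_normK (num_real c))
    ltr_pXn2r ?nnegrE.
nra.
Qed.

(** A simple zero is isolated, and a compact set of isolated points is finite. *)
Lemma zeros_locally_finite (R : realType) (f : R -> R) :
  simple_zeros f -> locally_finite [set t | f t = 0].
Proof.
move=> sf K cK.
have cf := simple_zeros_continuous sf.
have cKZ : compact (K `&` [set t | f t = 0]).
  apply: compact_closedI => //.
  rewrite (_ : [set t | f t = 0] = f @^-1` [set 0])//.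
  by apply: closed_comp => //; exact: closed_eq.
have /choice[e he] : forall z, exists e, 0 < e /\ (f z = 0 ->
    forall h, h != 0 -> `|h| < e -> f (z + h) != 0).
  move=> z; have [fz|fz] := eqVneq (f z) 0; last first.
    by exists 1; split => // fz0; rewrite fz0 eqxx in fz.
  have [e e0 hz] := sign_near_simple_zero sf fz.
  exists e; split => // _ h h0 /(hz h h0).
  by apply: contraTN => /eqP ->; rewrite !mulr0 ltxx.
move: cKZ; rewrite compact_cover => /(_ R (K `&` [set t | f t = 0])
  (fun z => ball z (e z))) [|x Kx|D DK KD].
- by move=> z _; apply: ball_open; exact: (he z).1.
- by exists x => //=; apply: ballxx; exact: (he x).1.
- apply: (sub_finite_set _ (finite_fset D)) => x KZx.
  have [z zD /=] := KD _ KZx; rewrite /ball/= distrC => xz.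
  have /set_mem[Kz fz] := DK z zD.
  have [->//|xnz] := eqVneq x z.
  have := (he z).2 fz (x - z); rewrite subr_eq0 xnz => /(_ isT xz).
  by rewrite subrKC; case: KZx => _ /= ->; rewrite eqxx.
Qed.

Lemma same_sign (R : realType) (f : R -> R) (a b : R) : continuous f -> a <= b ->
  (forall t, a <= t <= b -> f t != 0) -> 0 < f a * f b.
Proof.
move=> cf ab nz; rewrite ltNge; apply/negP => fab.
have [||t] := @IVT R f a b 0 ab.
- exact: continuous_subspaceT.
- move: fab; rewrite /Num.min /Num.max.
  by case: ltP => h fab; apply/andP; split; nra.
- rewrite in_itv/= => abt ft.
  by have := nz t abt; rewrite ft eqxx.
Qed.

(** Each simple zero flips the sign of [f], so the sign of [f a * f b] is the
    parity of the number of zeros in between. This is all that the zero set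
    tells about the values of [f]. *)
Lemma sign_change_odd (R : realType) (f : R -> R) (a b : R) :
  simple_zeros f -> a < b -> f a != 0 -> f b != 0 ->
  (f a * f b < 0) = odd (points_between [set t | f t = 0] a b).
Proof.
move=> sf ab fa; have lfZ := zeros_locally_finite sf.
have cf := simple_zeros_continuous sf.
set Z := [set t | f t = 0].
have [n] := ubnP (points_between Z a b); elim: n b ab => // n IH b ab.
rewrite ltnS => nb fb.
have [|no] := pselect (Z `&` `]a, b[ !=set0); last first.
  rewrite /points_between (_ : Z `&` _ = set0); last first.
    by rewrite -subset0 => t Zt; apply: no; exists t.
  rewrite fset_set0 cardfs0/=; apply/negbTE; rewrite -leNgt ltW//.
  apply: same_sign => //; first exact: ltW.
  move=> t /andP[]; rewrite le_eqVlt => /orP[/eqP <-//|a_t].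
  rewrite le_eqVlt => /orP[/eqP ->//|tb].
  by apply/eqP => ft; apply: no; exists t; split => //=; rewrite in_itv/= a_t.
move=> /(points_between_last lfZ)[c0 [z [[ac0 c0z zb fz] [zlast cnt]]]].
have [e e0 he] := sign_near_simple_zero sf fz.
(* [z - h] and [z + h] enclose the last zero [z], and no other. *)
pose h := Num.min (e / 2) (Num.min ((z - c0) / 2) ((b - z) / 2)).
have h0 : 0 < h.
  by rewrite !lt_min !divr_gt0 ?subr_gt0.
have hle : [/\ h < e, h < z - c0 & h < b - z].
  have := lexx h; rewrite {2}/h !le_min => /and3P[]; split; lra.
case: hle => h_e hz hb.
have zm : 0 < derive1 f z * (- h * f (z - h)).
  by apply: he; rewrite ?oppr_eq0 ?normrN ?gtr0_norm// gt_eqF.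
have zp : 0 < derive1 f z * (h * f (z + h)).
  by apply: he; rewrite ?gtr0_norm// gt_eqF.
have fzhb : 0 < f (z + h) * f b.
  apply: same_sign => //; first by lra.
  move=> t /andP[ht]; rewrite le_eqVlt => /orP[/eqP ->//|tb].
  by apply/eqP => /(zlast t _ tb); apply; lra.
have Ec := cnt (z - h) ltac:(lra) ltac:(lra).
have fzm : f (z - h) != 0 by apply: contraTneq zm => ->; rewrite !mulr0 ltxx.
rewrite -Ec /= -IH//; last 2 first.
- lra.
- by rewrite -Ec in nb.
have fzz : f (z - h) * f (z + h) < 0.
  have := mulr_gt0 zm zp; set c := derive1 f z.
  rewrite [X in 0 < X](_ : _ = - ((c * h) ^+ 2 * (f (z - h) * f (z + h)))); last by ring.
  rewrite oppr_gt0 pmulr_rlt0// exprn_even_gt0//= mulf_neq0 ?(gt_eqF h0)//.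
  by apply: contraTneq zm; rewrite -/c => ->; rewrite mul0r ltxx.
have fzb : f (z - h) * f b < 0.
  have := mulr_gt0 fzhb fzhb => {}fzhb2.
  nra.
by rewrite -leNgt; apply/idP/idP; nra.
Qed.

(** Conversely, countably many signs tell whether an interval contains a zero. *)
Lemma zero_between_sign_change (R : realType) (f : R -> R) (a b : R) :
  simple_zeros f ->
  ([set t | f t = 0] `&` `]a, b[ !=set0) <->
  exists q r : rat, [/\ a < ratr q, ratr q < ratr r :> R, ratr r < b &
    f (ratr q) * f (ratr r) < 0].
Proof.
move=> sf; split=> [[z []]|[q [r [aq qr rb fqr]]]].
  rewrite /= in_itv/= => fz /andP[az zb].
  have [e e0 he] := sign_near_simple_zero sf fz.
  have /rat_in_itvoo[q] : Num.max a (z - e) < z by rewrite gt_max az ltrBlDr ltrDl.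
  rewrite in_itv/= gt_max => /andP[/andP[aq eq] qz].
  have /rat_in_itvoo[r] : z < Num.min b (z + e) by rewrite lt_min zb ltrDl.
  rewrite in_itv/= lt_min => /andP[zr /andP[rb re]].
  exists q, r; split => //; first exact: lt_trans zr.
  have := he (ratr q - z); rewrite subr_eq0 lt_eqF//.
  rewrite ltr0_norm ?subr_lt0// subrKC => /(_ isT ltac:(lra)) zm.
  have := he (ratr r - z); rewrite subr_eq0 gt_eqF//.
  rewrite gtr0_norm ?subr_gt0// subrKC => /(_ isT ltac:(lra)) zp.
  have := mulr_gt0 zm zp; set c := derive1 f z.
  rewrite [X in 0 < X](_ : _ = c ^+ 2 * ((ratr r - z) * (z - ratr q)) *
    (- (f (ratr q) * f (ratr r)))); last by ring.
  rewrite pmulr_rgt0 ?oppr_gt0// mulr_gt0//.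
    rewrite exprn_even_gt0//=.
    by apply: contraTneq zm; rewrite -/c => ->; rewrite mul0r ltxx.
  by rewrite mulr_gt0 ?subr_gt0.
have [//|no] := pselect ([set t | f t = 0] `&` `]a, b[ !=set0).
have : 0 < f (ratr q) * f (ratr r).
  apply: same_sign; [exact: simple_zeros_continuous|exact: ltW|].
  move=> t /andP[qt tr]; apply/eqP => ft; apply: no; exists t; split => //=.
  by rewrite in_itv/= (lt_le_trans aq)// (le_lt_trans tr).
by rewrite ltNge ltW.
Qed.

(** * From hitting events to counts *)

Section counting_measurability.
Context d (T : measurableType d) (R : realType).
Variable Z : T -> set R.
Hypothesis lfZ : forall w, locally_finite (Z w).
Hypothesis hitZ : forall a b, measurable [set w | Z w `&` `]a, b[ !=set0].

(* [`]a, b[] contains [k.+1] points if and only if some rational [q] in it has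
   [k] points on its left and one on its right. *)
Let measurable_points_between_ge (k : nat) (a b : R) :
  measurable [set w | (k <= points_between (Z w) a b)%N].
Proof.
elim: k b => [|k IH] b.
  by rewrite (_ : [set _ | _] = setT)// -subTset => w.
have -> : [set w | (k.+1 <= points_between (Z w) a b)%N] =
    \bigcup_(q : rat) (if a < ratr q then
      [set w | (k <= points_between (Z w) a (ratr q))%N] `&`
      [set w | Z w `&` `]ratr q, b[ !=set0] else set0).
  rewrite predeqE => w; split=> [/= kab|[q _]].
    have Zab : Z w `&` `]a, b[ !=set0.
      apply/set0P; apply: contraTneq kab.
      by rewrite /points_between => ->; rewrite fset_set0 cardfs0.
    have [c0 [z [[ac0 c0z zb Zz] [_ cnt]]]] := points_between_last (lfZ w) Zab.
    have [q] := rat_in_itvoo c0z.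
    rewrite in_itv/= => /andP[c0q qz]; exists q => //.
    rewrite (le_lt_trans ac0 c0q); split; first by rewrite /= -ltnS cnt.
    by exists z; split => //=; rewrite in_itv/= qz.
  case: ifPn => // aq [/= kaq [z [Zz]]].
  rewrite /= in_itv/= => /andP[qz zb].
  apply: leq_ltn_trans kaq _.
  rewrite /points_between.
  have finq := locally_finite_oo a (ratr q) (lfZ w).
  have finb := locally_finite_oo a b (lfZ w).
  apply: fproper_ltn_card; rewrite fproperEneq; apply/andP; split; last first.
    rewrite -fset_set_sub//. move=> t [Zt].
    rewrite /= in_itv/= => /andP[a_t tq]; split => //.
    by rewrite /= in_itv/= a_t (lt_trans tq (lt_trans qz zb)).
  have : z \in fset_set (Z w `&` `]a, b[).
    by rewrite in_fset_set//; apply/mem_set; split; rewrite //= in_itv/= (lt_trans aq).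
  apply: contraTneq => <-.
  by rewrite in_fset_set// notin_setE => -[_]; rewrite /= in_itv/= [z < _]ltNge ltW
    ?andbF.
apply: bigcupT_measurable_rat => q; case: ifP => // _.
exact: measurableI.
Qed.

Let measurable_counting_oo (a b : R) :
  measurable_fun setT (fun w => counting (Z w `&` `]a, b[) : \bar R).
Proof.
under eq_fun do rewrite counting_oo//.
move=> _ Y mY; rewrite setTI.
rewrite (_ : _ @^-1` _ = \bigcup_k (if k%:R%:E \in Y then
    [set w | (k <= points_between (Z w) a b)%N] `\`
    [set w | (k.+1 <= points_between (Z w) a b)%N] else set0)).
  apply: bigcupT_measurable => k; case: ifP => // _.
  by apply: measurableD; exact: measurable_points_between_ge.
rewrite predeqE => w; split=> [Yw|[k _]].
  exists (points_between (Z w) a b) => //.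
  by rewrite mem_set//; split => /=; rewrite ?leqnn ?ltnn.
case: ifPn => // /set_mem Yk [/= kw /negP]; rewrite -leqNgt => wk.
by rewrite (_ : points_between _ _ _ = k)//; apply/eqP; rewrite eqn_leq wk.
Qed.

Let sub_oo_measurable (a b : R) (w : T) (A : set R) :
  A `<=` Z w `&` `]a, b[ -> measurable A.
Proof.
move=> AZ; apply: countable_measurable => //.
apply: finite_set_countable; apply: sub_finite_set AZ _.
exact: locally_finite_oo.
Qed.

Let measurable_counting_bounded (a b : R) (B : set R) : measurable B ->
  measurable_fun setT (fun w => counting (Z w `&` `]a, b[ `&` B) : \bar R).
Proof.
pose P (B : set R) :=
  measurable_fun setT (fun w => counting (Z w `&` `]a, b[ `&` B) : \bar R).
move=> mB; change (P B).
have mE : @measurable _ (measurableTypeR R) = <<s @RGenOpens.G R >>.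
  exact: RGenOpens.measurableE.
apply: (dynkin_induction mE); last by rewrite -mE.
- move=> _ _ [x [y ->]] [x' [y' ->]].
  exists (Num.max x x'), (Num.min y y').
  rewrite predeqE => t /=; rewrite !in_itv/= gt_max lt_min.
  by split=> [[/andP[-> ->] /andP[-> ->]]|/andP[/andP[-> ->] /andP[-> ->]]].
- by rewrite /P; under eq_fun do rewrite setIT; exact: measurable_counting_oo.
- move=> _ [x [y ->]]; rewrite /P.
  rewrite (_ : (fun w => _) = (fun w => counting
      (Z w `&` `]Num.max a x, Num.min b y[) : \bar R)); last first.
    apply/funext => w; rewrite -setIA; congr (counting (_ `&` _)).
    rewrite predeqE => t /=; rewrite !in_itv/= gt_max lt_min.
    by split=> [[/andP[-> ->] /andP[-> ->]]|/andP[/andP[-> ->] /andP[-> ->]]].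
  exact: measurable_counting_oo.
- move=> S mS PS; rewrite /P.
  rewrite (_ : (fun w => _) = (fun w => counting (Z w `&` `]a, b[) -
      counting (Z w `&` `]a, b[ `&` S) : \bar R)%E).
    by apply: emeasurable_funB => //; exact: measurable_counting_oo.
  apply/funext => w.
  have fin A : A `<=` Z w `&` `]a, b[ -> (counting A : \bar R) \is a fin_num.
    move=> AZ; rewrite /counting asboolT//.
    by apply: sub_finite_set AZ _; exact: locally_finite_oo.
  have -> : (counting (Z w `&` `]a, b[) =
      counting (Z w `&` `]a, b[ `&` ~` S) +
      counting (Z w `&` `]a, b[ `&` S) :> \bar R)%E.
    rewrite -measureU //=; first by rewrite -setIUr setUC setUv setIT.
    - by apply: (@sub_oo_measurable a b w); exact: subIsetl.
    - by apply: (@sub_oo_measurable a b w); exact: subIsetl.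
    - by rewrite -subset0 => t [[_ ?] []].
  by rewrite addeK// fin.
- move=> F mF tF PF; rewrite /P.
  rewrite (_ : (fun w => _) = (fun w => \sum_(0 <= k <oo | k \in predT)
      counting (Z w `&` `]a, b[ `&` F k) : \bar R)%E).
    by apply: ge0_emeasurable_sum => [k w _ _|k _]; [exact: measure_ge0|exact: PF].
  apply/funext => w; rewrite setI_bigcupr measure_bigcup//=.
    by apply: eq_eseriesl => k; rewrite in_setT.
  - by move=> k _; apply: (@sub_oo_measurable a b w); exact: subIsetl.
  - exact: trivIset_setIl.
Qed.

(** A locally finite random set is determined by the events that it hits an open
    interval: these events give the counts of open intervals, and a
    pi-lambda argument extends them to Borel sets. As counts may be infinite,
    complements are only taken inside a bounded interval, which then grows. *)
Lemma measurable_counting_of_hits (B : set R) : measurable B ->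
  measurable_fun setT (fun w => counting (Z w `&` B) : \bar R).
Proof.
move=> mB.
apply: (@emeasurable_fun_cvg _ _ _ _
    (fun n w => counting (Z w `&` `]- n%:R, n%:R[ `&` B))) => [n|w _].
  exact: measurable_counting_bounded.
have mZn n : measurable (Z w `&` `]- n%:R, n%:R[ `&` B).
  by apply: (@sub_oo_measurable (- n%:R) n%:R w); exact: subIsetl.
have ZE : Z w `&` B = \bigcup_n (Z w `&` `]- n%:R, n%:R[ `&` B).
  rewrite -setI_bigcupl -setI_bigcupr; congr (_ `&` _).
  rewrite -[LHS]setIT; congr (_ `&` _).
  rewrite predeqE => t; split => // _; exists (Num.truncn `|t|).+1 => //=.
  by rewrite in_itv/= -ltr_norml truncnS_gt.
rewrite [X in _ --> X](_ : _ = counting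
  (\bigcup_n (Z w `&` `]- n%:R, n%:R[ `&` B))); last by rewrite -ZE.
apply: nondecreasing_cvg_mu => //; first exact: bigcupT_measurable.
move=> m n mn; apply/subsetPset; apply: setSI; apply: setIS.
apply: subset_itv; rewrite bnd_simp ?lerN2 ler_nat//.
Qed.

End counting_measurability.

(** * Completion and lower limits of events *)

Section completion.
Context d (T : measurableType d) (R : realType) (P : probability T R).

Lemma measurable_norm_le (Y : {RV P >-> R}) (e : R) :
  measurable [set w | `|Y w| <= e].
Proof.
rewrite -[X in measurable X]setTI; apply: measurable_fun_ler => //.
by apply: measurableT_comp => //; exact: measurable_funPT.
Qed.

Lemma completed_ae (G : set (set T)) (A B : set T) :
  completed P G A -> {ae P, forall w, A w <-> B w} -> completed P G B.
Proof.
move=> mA AB.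
have neg N : P.-negligible N ->
    @measurable _ (g_sigma_algebraType (G `|` P.-negligible)) N.
  by move=> nN; apply: sub_sigma_algebra; right.
have -> : B = (A `\` (A `\` B)) `|` (B `\` A).
  rewrite setDD predeqE => w; split=> [Bw|[[]//|[]//]].
  by have [Aw|nAw] := pselect (A w); [left|right].
apply: (@measurableU _ (g_sigma_algebraType (G `|` P.-negligible))).
  apply: measurableD => //; apply: neg.
  by apply: negligibleS AB => w [Aw nBw] /= [/(_ Aw)].
by apply: neg; apply: negligibleS AB => w [Bw nAw] /= [_ /(_ Bw)].
Qed.

Lemma measure_liminf_le (A : (set T)^nat) (c : \bar R) :
  (forall n, measurable (A n)) -> (forall n, P (A n) <= c)%E ->
  (P (\bigcup_N \bigcap_(n >= N) A n) <= c)%E.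
Proof.
move=> mA Ac.
have mI N : measurable (\bigcap_(n >= N) A n)
  by apply: bigcap_measurable => //; exists N => /=.
have cv : P (\bigcap_(n >= N) A n) @[N --> \oo] -->
    P (\bigcup_N \bigcap_(n >= N) A n).
  apply: nondecreasing_cvg_mu => //; first exact: bigcupT_measurable.
  move=> N M NM; apply/subsetPset => w h n /= Mn; apply: h => /=.
  exact: leq_trans Mn.
rewrite -(cvg_lim _ cv)//; apply: lime_le; first by apply/cvg_ex; eexists; exact: cv.
apply: nearW => N; apply: le_trans (Ac N).
by apply: le_measure; rewrite ?inE// => w; apply => /=.
Qed.

End completion.

(** * Small balls and correlations of Gaussian variables *)

Section gaussian_small_ball.
Context (R : realType).
Local Notation mu := (@lebesgue_measure R).

(** [normal_pdf] is the density: it is a Radon-Nikodym derivative of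
    [normal_prob], and such a derivative is almost everywhere unique. *)
Lemma integral_normal_prob (m s : R) (f : R -> \bar R) :
  (normal_prob m s).-integrable setT f ->
  (\int[normal_prob m s]_x f x = \int[mu]_x (f x * (normal_pdf m s x)%:E))%E.
Proof.
move=> intf.
have dom := normal_prob_dominates m s.
rewrite -(Radon_Nikodym_change_of_variables dom)//=.
have mpdf : measurable_fun setT (fun x => (normal_pdf m s x)%:E).
  by apply/measurable_EFinP; exact: measurable_normal_pdf.
have mf := measurable_int _ intf.
apply: ae_eq_integral => //.
- apply: emeasurable_funM => //.
- exact: emeasurable_funM.
- apply: ae_eqe_mul2l; rewrite Radon_NikodymE//=.
  case: cid => /= h [h1 h2 h3].
  by apply: integral_ae_eq => //= E _ mE; rewrite -h3.
Qed.

Lemma normal_peak_double (s : R) : normal_peak s = 2 * normal_peak (2 * s).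
Proof.
rewrite /normal_peak.
have -> : (2 * s) ^+ 2 * pi *+ 2 = 2 ^+ 2 * (s ^+ 2 * pi *+ 2) by ring.
rewrite sqrtrM ?sqr_ge0// sqrtr_sqr ger0_norm// invfM mulrA divff ?mul1r//.
Qed.

(** Doubling the deviation absorbs the factor [(x - m) ^+ 2], so that the
    variance of a normal law is at most [6 * s ^+ 2] without computing it: only
    [1 + z <= expR z] is needed. *)
Lemma sqr_normal_pdf_le (m s x : R) : s != 0 ->
  (x - m) ^+ 2 * normal_pdf m s x <= 6 * s ^+ 2 * normal_pdf m (2 * s) x.
Proof.
move=> s0; have s20 : 2 * s != 0 by rewrite mulf_neq0.
have s2 : 0 < s ^+ 2 by rewrite exprn_even_gt0.
rewrite !normal_pdfE// normal_peak_double /normal_fun.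
set z := (x - m) ^+ 2 / (s ^+ 2 *+ 2).
have z0 : 0 <= z by rewrite /z divr_ge0 ?sqr_ge0// mulrn_wge0// ltW.
have -> : - (x - m) ^+ 2 / (s ^+ 2 *+ 2) = - z by rewrite mulNr.
have -> : - (x - m) ^+ 2 / ((2 * s) ^+ 2 *+ 2) = - (z / 4).
  by rewrite /z; field.
have -> : (x - m) ^+ 2 = z * (s ^+ 2 *+ 2) by rewrite divfK// mulrn_eq0/= gt_eqF.
have p0 := normal_peak_gt0 s20; set p := normal_peak _ in p0 *.
have -> : expR (- z) = expR (- (z / 4)) * expR (- (z * 3 / 4)).
  by rewrite -expRD; congr expR; field.
have e0 := expR_gt0 (- (z / 4)); set e := expR (- (z / 4)) in e0 *.
have : z * expR (- (z * 3 / 4)) <= 4 / 3.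
  rewrite expRN ler_pdivrMr ?expR_gt0//.
  by have := expR_ge1Dx (z * 3 / 4); lra.
set t := z * expR _ => t43.
have -> : z * (s ^+ 2 *+ 2) * (2 * p * (e * expR (- (z * 3 / 4)))) =
  4 * t * (s ^+ 2 * p * e) by rewrite /t; ring.
have -> : 6 * s ^+ 2 * (p * e) = 6 * (s ^+ 2 * p * e) by ring.
apply: ler_wpM2r; last lra.
by rewrite ltW// mulr_gt0// mulr_gt0.
Qed.

Lemma normal_prob_le_interval (m s e : R) : s != 0 -> 0 <= e ->
  (normal_prob m s `[(- e)%R, e] <= (normal_peak s * (2 * e))%:E)%E.
Proof.
move=> s0 e0; rewrite /normal_prob.
apply: (@le_trans _ _ (\int[mu]_(x in `[(- e)%R, e]) (normal_peak s)%:E)%E).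
  apply: ge0_le_integral => //=.
  - by move=> x _; rewrite lee_fin normal_pdf_ge0.
  - by apply/measurable_EFinP/measurable_funTS; exact: measurable_normal_pdf.
  - by move=> x _; rewrite lee_fin normal_pdf_ub.
rewrite integral_cst//= lebesgue_measure_itv/= lte_fin.
case: ifPn => _; last by rewrite mule0 lee_fin mulr_ge0 ?normal_peak_ge0 ?mulr_ge0.
by rewrite -EFinB -EFinM lee_fin; apply: ler_wpM2l; [exact: normal_peak_ge0|lra].
Qed.

End gaussian_small_ball.

Section gaussian_variables.
Context d (T : measurableType d) (R : realType) (P : probability T R).
Local Notation mu := (@lebesgue_measure R).

Lemma sqr_integrable_Lfun2 (Y : T -> R) : measurable_fun setT Y ->
  (\int[P]_w ((Y w) ^+ 2)%:E < +oo)%E -> Y \in Lfun P 2%:E.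
Proof.
move=> mY intY; rewrite inE; apply/andP; split; rewrite inE/=; first exact: mY.
rewrite /finite_norm unlock/= poweR_lty//.
under eq_integral => x _ do rewrite /= powR_mulrn// -normrX ger0_norm ?sqr_ge0//.
exact: intY.
Qed.

Definition standardized (Y : {RV P >-> R}) :=
  ('E_P[Y] = 0)%E /\ ('V_P[Y] = 1)%E.

Lemma standardized_second_moment (Y : {RV P >-> R}) : standardized Y ->
  (\int[P]_w ((Y w) ^+ 2)%:E = 1)%E.
Proof.
move=> [E0]; rewrite /variance unlock E0/= unlock => <-.
by apply: eq_integral => w _; rewrite /= !fctE/= subr0 expr2.
Qed.

Lemma standardized_Lfun2 (Y : {RV P >-> R}) : standardized Y ->
  (Y : T -> R) \in Lfun P 2%:E.
Proof.
move=> sY; apply: sqr_integrable_Lfun2; first exact: measurable_funPT.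
by rewrite standardized_second_moment// ltry.
Qed.

Lemma standardized_shift (Y : {RV P >-> R}) (m : R) : standardized Y ->
  (1 <= \int[P]_w ((Y w - m) ^+ 2)%:E < +oo)%E.
Proof.
move=> sY; have Y2 := standardized_Lfun2 sY.
have Ym2 : (Y \- cst m)%R \in Lfun P 2%:E.
  by rewrite rpredB ?lee1n// => ?; exact: (Lfun_cst P m 2).
have := varianceE Ym2; rewrite varianceB_cst_r// sY.2 => VE.
have EE : 'E_P[(Y \- cst m) ^+ 2]%E = (\int[P]_w ((Y w - m) ^+ 2)%:E)%E.
  by rewrite unlock; apply: eq_integral.
have Efin : ('E_P[Y \- cst m] \is a fin_num)%E.
  by apply: expectation_fin_num; apply: Lfun_subset12 => //; exact: fin_num_measure.
rewrite EE in VE.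
apply/andP; split.
  rewrite VE leeBlDr; last by rewrite fin_numX.
  by rewrite leeDl// sqre_ge0.
have := Lfun2_integrable_sqr Ym2 => /integrableP[_].
by under eq_integral do rewrite /= ger0_norm ?sqr_ge0//.
Qed.

(** A normal law of variance [1] cannot be too concentrated: the bound on its
    variance yields [1 <= 6 * s ^+ 2], hence a density at most [2]. The constant
    is the same for all standardized Gaussian variables. *)
Lemma gaussian_small_ball (Y : {RV P >-> R}) (e : R) :
  gaussian_variable P Y -> standardized Y -> 0 <= e ->
  (P [set w | `|Y w| <= e]%R <= (4 * e)%:E)%E.
Proof.
move=> [m [s law]] sY e0.
have mY : @measurable_fun _ _ T (measurableTypeR R) setT Y.
  have mY : measurable_fun setT (Y : T -> R) by exact: measurable_funPT.
  exact: mY.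
have /andP[var1 varoo] := standardized_shift m sY.
have msq : measurable_fun setT (fun x : measurableTypeR R => ((x - m) ^+ 2)%:E).
  apply/measurable_EFinP; apply: measurable_funX.
  exact: measurable_funB.
have push (nu : {measure set (measurableTypeR R) -> \bar R}) :
    (forall A, measurable A -> pushforward P Y A = nu A) ->
    (\int[P]_w ((Y w - m) ^+ 2)%:E = \int[nu]_x ((x - m) ^+ 2)%:E)%E.
  move=> lawE.
  have := ge0_integral_pushforward mY P (D := setT)
    (f := fun x : measurableTypeR R => ((x - m) ^+ 2)%:E) measurableT msq.
  rewrite preimage_setT /= => <-; last by move=> x _; rewrite lee_fin sqr_ge0.
  by apply: eq_measure_integral => A mA _; exact: lawE.
rewrite /gaussian_law in law; have [s0|s0] := eqVneq s 0.
  move: var1; rewrite (push (dirac (m : measurableTypeR R))); last first.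
    by move=> A /law; rewrite s0 eqxx.
  by rewrite integral_dirac//= diracT subrr expr0n/= mule0 lee_fin ler10.
have lawE A : measurable A -> pushforward P Y A = normal_prob m s A.
  by move=> /law; rewrite (negbTE s0).
have ve := push (normal_prob m s) lawE.
have s6 : 1 <= 6 * s ^+ 2.
  rewrite -lee_fin; apply: (le_trans var1); rewrite ve integral_normal_prob.
    apply: (@le_trans _ _ (\int[mu]_x ((6 * s ^+ 2)%:E * (normal_pdf m (2 * s) x)%:E))%E).
      apply: ge0_le_integral => //=.
      - by move=> x _; rewrite -EFinM lee_fin mulr_ge0 ?sqr_ge0 ?normal_pdf_ge0.
      - apply: emeasurable_funM => //.
        by apply/measurable_EFinP; exact: measurable_normal_pdf.
      - apply: emeasurable_funM => //.
        by apply/measurable_EFinP; exact: measurable_normal_pdf.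
      - by move=> x _; rewrite -!EFinM lee_fin sqr_normal_pdf_le.
    rewrite integralZl//=; last exact: integrable_normal_pdf.
    by rewrite integral_normal_pdf mule1.
  apply/integrableP; split => //.
  under eq_integral do rewrite /= ger0_norm ?sqr_ge0//.
  by rewrite -ve.
have -> : [set w | `|Y w| <= e] = Y @^-1` `[- e, e].
  by rewrite predeqE => w; split; rewrite /= in_itv/= ler_norml.
rewrite -[leLHS]/(pushforward P Y `[- e, e]) lawE//.
apply: le_trans (normal_prob_le_interval _ s0 e0) _.
rewrite lee_fin [leLHS](_ : _ = normal_peak s * 2 * e); last by ring.
apply: ler_wpM2r => //.
have : normal_peak s <= 2; last lra.
rewrite /normal_peak -[2 in leRHS]invrK lef_pV2 ?posrE ?invr_gt0 ?sqrtr_gt0//; last first.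
  by rewrite mulrn_wgt0// mulr_gt0 ?pi_gt0// exprn_even_gt0.
rewrite -[leLHS]ger0_norm ?invr_ge0// -sqrtr_sqr ler_wsqrtr//.
have := pi_ge2 R => pi2; nra.
Qed.

(** The variance of [Y - eps * Y'] is [2 - 2 * (eps * c)], which is small when
    the correlation [c] is close to the sign [eps]. *)
Lemma chebyshev_correlation (Y Y' : {RV P >-> R}) (c eps e : R) :
  standardized Y -> standardized Y' -> covariance P Y Y' = c%:E ->
  eps ^+ 2 = 1 -> 0 < e ->
  (P [set w | e <= `|Y w - eps * Y' w|]%R <= (e ^- 2 * (2 - 2 * (eps * c)))%:E)%E.
Proof.
move=> sY sY' cYY' eps2 e0.
have Y2 := standardized_Lfun2 sY; have Y'2 := standardized_Lfun2 sY'.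
have Pfin : P setT \is a fin_num := fin_num_measure P _ measurableT.
have Y1 := Lfun_subset12 Pfin Y2; have Y'1 := Lfun_subset12 Pfin Y'2.
have eY'2 : (eps \o* Y')%R \in Lfun P 2%:E by apply: Lfun_scale => //; rewrite ler1n.
pose W : {RV P >-> R} := (Y - cst eps * Y')%R.
have WE : (W : T -> R) = (Y \- eps \o* Y')%R.
  by apply/funext => w /=; rewrite mulrC.
have := chebyshev W e0; rewrite WE.
have -> : ('E_P[(Y \- eps \o* Y')%R] = 0)%E.
  rewrite expectationB//; last exact: Lfun_scale.
  by rewrite expectationZl// sY.1 sY'.1 mule0 sube0.
have -> : ('V_P[(Y \- eps \o* Y')%R] = (2 - 2 * (eps * c))%:E)%E.
  rewrite varianceB// varianceZ// sY.2 sY'.2 eps2 covarianceZr//.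
    by rewrite cYY' mul1e -!EFinM -!EFinD; congr EFin; ring.
  exact: Lfun2_mul_Lfun1.
rewrite -EFinM; apply: le_trans.
rewrite le_eqVlt; apply/orP; left; apply/eqP; congr (P _).
by rewrite predeqE => w /=; rewrite subr0 [Y' w * _]mulrC.
Qed.

End gaussian_variables.

(** * Double zeros *)

Section double_zeros.
Context d (T : measurableType d) (R : realType) (P : probability T R).
Variables (X : R -> {RV P >-> R}) (K : R).
Hypothesis K0 : 0 <= K.
Hypothesis small_ball : forall t e, 0 <= e ->
  (P [set w | `|X t w| <= e]%R <= (K * e)%:E)%E.

Definition double_zero (f : R -> R) (t : R) :=
  [/\ derivable f t 1, f t = 0 & derive1 f t = 0].

Let grid (m n k : nat) : R := k%:R / n.+1%:R - m%:R.

Let grid_small (m j n : nat) : set T :=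
  \bigcup_(k < (2 * m * n.+1).+1)
    [set w | `|X (grid m n k) w| <= j.+1%:R^-1 / n.+1%:R].

Let measurable_grid_small (m j n : nat) : measurable (grid_small m j n).
Proof. by apply: bigcup_measurable => k _; exact: measurable_norm_le. Qed.

Let grid_small_le (m j n : nat) :
  (P (grid_small m j n) <= ((2 * m%:R + 1) * K / j.+1%:R)%:E)%E.
Proof.
rewrite /grid_small bigcup_mkord.
pose A k := [set w | `|X (grid m n k) w| <= j.+1%:R^-1 / n.+1%:R].
have mA k : (k < (2 * m * n.+1).+1)%N -> measurable (A k).
  by move=> _; exact: measurable_norm_le.
apply: le_trans (Boole_inequality P mA) _.
have e0 : 0 <= (j.+1%:R^-1 / n.+1%:R : R) by rewrite divr_ge0// invr_ge0.
apply: (@le_trans _ _ (\sum_(k < (2 * m * n.+1).+1)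
    (K * (j.+1%:R^-1 / n.+1%:R))%:E)%E).
  by apply: lee_sum => k _; exact: small_ball.
rewrite sumEFin lee_fin sumr_const card_ord -[leLHS]mulr_natl.
have j0 : 0 <= (j.+1%:R^-1 : R) by rewrite invr_ge0.
have n0 : (n.+1%:R : R) != 0 by rewrite pnatr_eq0.
rewrite [leLHS](_ : _ = (2 * m%:R + n.+1%:R^-1) * (K * j.+1%:R^-1)); last first.
  have -> : (2 * m * n.+1).+1%:R = 2 * m%:R * n.+1%:R + 1 :> R.
    by rewrite -natr1 !natrM.
  by field; rewrite !(addrC 1) !natr1 !pnatr_eq0.
rewrite -mulrA; apply: ler_wpM2r; first exact: mulr_ge0.
by rewrite lerD2l invf_le1 ?ltr0n// ler1n.
Qed.

(** Bulinskaya's argument. If [X] vanishes with its derivative at [t], then for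
    each [j] and all fine meshes, the value at the grid point next to [t] is at
    most [j.+1%:R^-1] times the mesh. A given grid point is that close to zero
    with probability at most [K * j.+1%:R^-1] times the mesh; as the number of
    grid points is inversely proportional to the mesh, the union bound is of
    order [j.+1%:R^-1], uniformly in the mesh. Only differentiability at the
    double zero matters, and all the events involved are measurable because
    they look at grid points only. *)
Lemma double_zero_negligible :
  P.-negligible [set w | exists t, double_zero (X ^~ w) t].
Proof.
pose L m j := \bigcup_N \bigcap_(n >= N) grid_small m j n.
have mL m j : measurable (L m j).
  by apply: bigcupT_measurable => N; apply: bigcap_measurable => //; exists N => /=.
pose Bad m := \bigcap_j L m j.
have mBad m : measurable (Bad m) by apply: bigcapT_measurable.
have Bad0 m : P (Bad m) = 0%E.
  apply/eqP; rewrite eq_le measure_ge0 andbT.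
  apply/lee_addgt0Pr => e e0; rewrite add0e.
  pose c := (2 * m%:R + 1) * K.
  have c0 : 0 <= c by rewrite mulr_ge0// addr_ge0// mulr_ge0.
  pose j := Num.truncn (c / e).
  apply: (@le_trans _ _ (P (L m j))).
    by apply: le_measure; rewrite ?inE//; exact: bigcap_inf.
  apply: (@le_trans _ _ (c / j.+1%:R)%:E).
    by apply: measure_liminf_le => n; [exact: measurable_grid_small|exact: grid_small_le].
  rewrite lee_fin ler_pdivrMr// mulrC -ler_pdivrMr//.
  exact/ltW/truncnS_gt.
apply: (@negligibleS _ _ _ _ (\bigcup_m Bad m)); last first.
  by apply: negligible_bigcup => m; apply/negligibleP; [exact: mBad|exact: Bad0].
move=> w [t [df ft f't]].
pose m := (Num.truncn `|t|).+1.
have tm : - m%:R < t < m%:R by rewrite -ltr_norml truncnS_gt.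
have /andP[tm1 tm2] := tm.
exists m => // j _.
have e0 : 0 < (j.+1%:R^-1 : R) by rewrite invr_gt0.
have [d0 d00 hd] := difference_quotient_near df ft e0.
pose N := Num.truncn d0^-1; exists N => // n /= Nn.
have n0 : 0 < (n.+1%:R : R) by [].
have nd : n.+1%:R^-1 < d0.
  rewrite invf_plt ?posrE// (lt_le_trans (truncnS_gt _))// ler_nat.
  by rewrite ltnS.
have tm0 : 0 <= (t + m%:R) * n.+1%:R by rewrite mulr_ge0//; lra.
(* [k] is the index of the last grid point that is at most [t]. *)
pose k := Num.truncn ((t + m%:R) * n.+1%:R).
have /andP[k1 k2] := truncn_itv tm0; rewrite -/k in k1 k2.
exists k => /=.
  rewrite ltnS -(ler_nat R) (le_trans k1)// !natrM ler_pM2r//; lra.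
have gk : 0 <= t - grid m n k < n.+1%:R^-1.
  have E : t - grid m n k = ((t + m%:R) * n.+1%:R - k%:R) / n.+1%:R.
    by rewrite /grid; field; rewrite addrC natr1 pnatr_eq0.
  rewrite E divr_ge0 ?subr_ge0//= -[ltRHS]mul1r ltr_pM2r ?invr_gt0//.
  by rewrite ltrBlDl natr1.
set h := grid m n k - t.
have hn : `|h| <= n.+1%:R^-1.
  by rewrite /h distrC ger0_norm; [exact: ltW (andP gk).2|exact: (andP gk).1].
have -> : grid m n k = t + h by rewrite /h subrKC.
have [->|h0] := eqVneq h 0; first by rewrite addr0 ft normr0 divr_ge0// ltW.
have := hd h h0 (le_lt_trans hn nd); rewrite f't subr0 normrM normfV.
rewrite ltr_pdivrMr ?normr_gt0// => /ltW/le_trans; apply.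
by rewrite ler_pM2l.
Qed.

End double_zeros.

(** * Sign changes seen from the remote past *)

Section past_determines_signs.
Context d (T : measurableType d) (R : realType) (P : probability T R).
Variables (X : R -> {RV P >-> R}) (C : R -> R) (K : R).
Hypothesis K0 : 0 <= K.
Hypothesis small_ball : forall t e, 0 <= e ->
  (P [set w | `|X t w| <= e]%R <= (K * e)%:E)%E.
Hypothesis ae_simple : {ae P, forall w, simple_zeros (X ^~ w)}.

Definition sign_change (a b : R) : set T := [set w | X a w * X b w < 0].

Lemma measurable_sign_change (a b : R) : measurable (sign_change a b).
Proof.
rewrite -[X in measurable X]setTI; apply: measurable_fun_ltr => //.
by apply: measurable_funM; exact: measurable_funPT.
Qed.

Lemma ae_neq0 (t : R) : {ae P, forall w, X t w != 0}.
Proof.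
exists [set w | `|X t w| <= 0]; split.
- exact: measurable_norm_le.
- apply/eqP; rewrite eq_le measure_ge0 andbT.
  by have := small_ball t (lexx 0); rewrite mulr0.
- by move=> w /= /negP; rewrite negbK => /eqP ->; rewrite normr0.
Qed.

Definition odd_counts : set (\bar R)  :=
  \bigcup_(n in [set n | odd n]) [set n%:R%:E].

Lemma measurable_odd_counts : measurable odd_counts.
Proof.
by apply: bigcup_measurable => n _; exact: emeasurable_set1.
Qed.

(** The sign change between [a] and [b] is the parity of the number of zeros in
    [`]a, b[], which is visible before time [t]. *)
Lemma past_sign_change (t a b : R) : a < b -> b <= t ->
  completed P (sigma_counts (fun w => zero_set (fun t => X t) w `&` `]-oo, t[))
    (sign_change a b).
Proof.
move=> ab bt.
pose Z w := zero_set (fun t => X t) w `&` `]-oo, t[.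
apply: (@completed_ae _ _ _ P _
  ((fun w => counting (Z w `&` `]a, b[) : \bar R) @^-1` odd_counts)).
  apply: sub_sigma_algebra; left; apply: sub_sigma_algebra.
  exists `]a, b[%classic => //.
  exists odd_counts; first exact: measurable_odd_counts.
  by rewrite setTI.
have na := ae_neq0 a; have nb := ae_neq0 b.
near=> w.
have sw : simple_zeros (X ^~ w) by near: w; exact: ae_simple.
have aw : X a w != 0 by near: w.
have bw : X b w != 0 by near: w.
rewrite /sign_change /= (sign_change_odd sw ab aw bw).
have -> : Z w `&` `]a, b[ = [set s | X s w = 0] `&` `]a, b[.
  rewrite predeqE => s; split=> [[[? _] ?]//|[Zs sab]]; split => //; split => //.
  by move: sab; rewrite /= !in_itv/= => /andP[_ sb]; exact: lt_le_trans bt.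
rewrite counting_oo; last exact: zeros_locally_finite.
split=> [[n on /= [/eqP]]|o]; last by eexists; first exact: o.
by rewrite eqr_nat => /eqP ->.
Unshelve. all: by end_near. Qed.

Lemma same_sign_close (x y e : R) : e < `|x| -> `|x - y| < e -> 0 < x * y.
Proof.
by move=> ex; rewrite ltr_norml; case: (ltrgt0P x) ex => [x0|x0|->]; nra.
Qed.

Section approximation.
Variables (u : nat -> R) (eps : nat -> R).
Hypothesis eps2 : forall n, eps n ^+ 2 = 1.
Hypothesis close : forall n q,
  (P [set w | 2^-1 ^+ n <= `|X q w - eps n * X (q - u n) w|]%R <=
    (2 * 2^-1 ^+ n)%:E)%E.

(* Off [bad q n], the value at [q] is further from zero than it is from
   [eps n * X (q - u n)], so both have the same sign. *)
Let bad (q : R) (n : nat) : set T :=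
  [set w | `|X q w| <= 2^-1 ^+ n] `|`
  [set w | 2^-1 ^+ n <= `|X q w - eps n * X (q - u n) w|].

Let measurable_far (q : R) (n : nat) :
  measurable [set w | 2^-1 ^+ n <= `|X q w - eps n * X (q - u n) w|].
Proof.
rewrite -[X in measurable X]setTI; apply: measurable_fun_ler => //.
apply: measurableT_comp => //; apply: measurable_funB; first exact: measurable_funPT.
by apply: measurable_funM => //; exact: measurable_funPT.
Qed.

Let measurable_bad (q : R) (n : nat) : measurable (bad q n).
Proof.
apply: measurableU; first exact: measurable_norm_le.
exact: measurable_far.
Qed.

Let bad_le (q : R) (n : nat) :
  (P (bad q n) <= (2 * (K + 2) / (2 ^ n.+1)%:R)%:E)%E.
Proof.
have h0 : 0 <= 2^-1 ^+ n :> R by rewrite exprn_ge0.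
have -> : 2 * (K + 2) / (2 ^ n.+1)%:R = K * 2^-1 ^+ n + 2 * 2^-1 ^+ n :> R.
  by rewrite natrX exprS exprVn; field; rewrite expf_neq0.
rewrite EFinD; apply: le_trans (leeD (small_ball q h0) (close n q)).
by apply: measureU2; [exact: measurable_norm_le|exact: measurable_far].
Qed.

Let bad_negligible (q : R) : P.-negligible (lim_sup_set (bad q)).
Proof.
apply/negligibleP.
  by apply: bigcapT_measurable => n; exact: bigcup_measurable.
apply: lim_sup_set_cvg0 => //.
apply: (@le_lt_trans _ _ (2 * (K + 2))%:E); last exact: ltry.
apply: le_trans (epsilon_trick0 xpredT _); last by rewrite mulr_ge0// addr_ge0.
by apply: lee_nneseries => // n _; exact: bad_le.
Qed.

Let eventually_close (q : R) : {ae P, forall w, exists N,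
  forall n, (N <= n)%N -> 0 < X q w * (eps n * X (q - u n) w)}.
Proof.
apply: negligibleS (bad_negligible q) => w /= /forallNP far N _.
have [//|no] := pselect ((\bigcup_(n >= N) bad q n) w).
exfalso; apply: (far N) => n Nn.
have /not_orP[/negP + /negP] : ~ bad q n w by move=> b; apply: no; exists n.
by rewrite -!ltNge; exact: same_sign_close.
Qed.

(** By Borel-Cantelli, almost surely [X a] and [eps n * X (a - u n)] have the same
    sign for large [n], and likewise at [b]. The unknown sign [eps n] is common
    to both ends, so it cancels in the product. The shift [N0] of the index
    leaves the lower limit unchanged, and allows for discarding the windows that
    are not yet before a given time. *)
Lemma sign_change_liminf (a b : R) (N0 : nat) :
  {ae P, forall w, (\bigcup_N \bigcap_(n >= N)
     sign_change (a - u (n + N0)%N) (b - u (n + N0)%N)) w <-> sign_change a b w}.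
Proof.
have ha := eventually_close a; have hb := eventually_close b.
near=> w.
have [Na Ha] : exists N, forall n, (N <= n)%N ->
  0 < X a w * (eps n * X (a - u n) w) by near: w.
have [Nb Hb] : exists N, forall n, (N <= n)%N ->
  0 < X b w * (eps n * X (b - u n) w) by near: w.
have E n : (Na <= n)%N -> (Nb <= n)%N ->
    sign_change (a - u n) (b - u n) w <-> sign_change a b w.
  move=> /Ha ha' /Hb hb'; rewrite /sign_change /=.
  have := mulr_gt0 ha' hb'.
  rewrite [X in 0 < X](_ : _ = eps n ^+ 2 *
    ((X a w * X b w) * (X (a - u n) w * X (b - u n) w))); last by ring.
  by rewrite eps2 mul1r => h; split; nra.
split=> [[N _ HN]|Sw].
  apply/(E (maxn N (maxn Na Nb) + N0)%N).
  - by rewrite (leq_trans _ (leq_addr _ _))// !leq_max leqnn orbT.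
  - by rewrite (leq_trans _ (leq_addr _ _))// !leq_max leqnn !orbT.
  - by apply: HN => /=; rewrite leq_max leqnn.
exists (maxn Na Nb) => // n /=; rewrite geq_max => /andP[nan nbn].
by apply/E => //; rewrite (leq_trans _ (leq_addr _ _)).
Unshelve. all: by end_near. Qed.

End approximation.

End past_determines_signs.

(** * Complete predictability *)

Section assembly.
Context d (T : measurableType d) (R : realType) (P : probability T R).

(** When the zeros are simple, the sign changes between rationals determine the
    zero set. Both the measurability of the zero set and its predictability are
    instances, for different [G]. *)
Lemma sigma_counts_sub_completed (X : R -> {RV P >-> R}) (G : set (set T)) :
  {ae P, forall w, simple_zeros (X ^~ w)} ->
  (forall q r : rat, (ratr q < ratr r :> R) ->
    completed P G (sign_change X (ratr q) (ratr r))) ->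
  sigma_counts (zero_set (fun t => X t)) `<=` completed P G.
Proof.
move=> ae_simple sgnG.
(* The counts are measurable if the set is locally finite for all [w], whence
   this modification on a negligible set. *)
pose Z w := if `[< simple_zeros (X ^~ w) >] then [set t | X t w = 0] else set0.
have lfZ w : locally_finite (Z w).
  rewrite /Z; case: asboolP => [|_ K _]; first exact: zeros_locally_finite.
  by rewrite setI0.
have ZE : {ae P, forall w, Z w = zero_set (fun t => X t) w}.
  by apply: filterS ae_simple => w sw; rewrite /Z asboolT.
have hitZ a b : @measurable _ (g_sigma_algebraType (G `|` P.-negligible))
    [set w | Z w `&` `]a, b[ !=set0].
  apply: (@completed_ae _ _ _ P G (\bigcup_(q : rat) \bigcup_(r : rat)
    (if (a < ratr q) && (ratr q < ratr r :> R) && (ratr r < b)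
     then sign_change X (ratr q) (ratr r) else set0))).
    apply: (@bigcupT_measurable_rat _ (g_sigma_algebraType (G `|` P.-negligible))) => q.
    apply: bigcupT_measurable_rat => r.
    case: ifP => [/andP[/andP[_ qr] _]|_]; last exact: measurable0.
    exact: sgnG.
  apply: filterS ae_simple => w sw.
  rewrite /= /Z asboolT//; split=> [[q _ [r _]]|].
    case: ifP => // /andP[/andP[aq qr] rb] s.
    by apply/(zero_between_sign_change _ _ sw); exists q, r.
  move/(zero_between_sign_change _ _ sw) => [q [r [aq qr rb s]]].
  by exists q => //; exists r => //; rewrite aq qr rb.
apply: smallest_sub; first exact: smallest_sigma_algebra.
move=> _ [B mB [Y mY <-]]; rewrite setTI.
apply: (@completed_ae _ _ _ P G ((fun w => counting (Z w `&` B) : \bar R) @^-1` Y)).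
  have := @measurable_counting_of_hits _
    (g_sigma_algebraType (G `|` P.-negligible)) R Z lfZ hitZ B mB measurableT Y mY.
  by rewrite setTI.
by apply: filterS ZE => w /= ->.
Qed.

Lemma sigma_counts_restrict (Z : T -> set R) (t : R) :
  sigma_counts (fun w => Z w `&` `]-oo, t[) `<=` sigma_counts Z.
Proof.
apply: smallest_sub; first exact: smallest_sigma_algebra.
move=> _ [B mB [Y mY <-]]; apply: sub_sigma_algebra.
exists (`]-oo, t[ `&` B); first exact: measurableI.
by exists Y => //; under [in RHS]eq_fun do rewrite -setIA.
Qed.

Lemma completed_sub (G H : set (set T)) :
  G `<=` completed P H -> completed P G `<=` completed P H.
Proof.
move=> GH; apply: smallest_sub; first exact: smallest_sigma_algebra.
by move=> A [/GH//|nA]; apply: sub_sigma_algebra; right.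
Qed.

Section stationary.
Variables (X : R -> {RV P >-> R}) (C : R -> R).
Hypothesis hX : stationary_gaussian_process X C.

Lemma stationary_standardized (t : R) : standardized (X t).
Proof.
case: hX => _ E0 covX C0; split; first exact: E0.
by rewrite /variance covX subrr C0.
Qed.

Lemma stationary_small_ball (t e : R) : 0 <= e ->
  (P [set w | `|X t w| <= e]%R <= (4 * e)%:E)%E.
Proof.
apply: gaussian_small_ball; last exact: stationary_standardized.
case: hX => /(_ 1%N (fun=> t) (fun=> 1)) + _ _ _.
by congr gaussian_variable; apply/funext => w; rewrite big_ord1 mul1r.
Qed.

Lemma stationary_simple_zeros :
  {ae P, forall w : T, class_C1 (fun t : R => X t w)} ->
  {ae P, forall w, simple_zeros (X ^~ w)}.
Proof.
move=> hC1.
have nodz : {ae P, forall w, ~ exists t, double_zero (X ^~ w) t}.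
  have := double_zero_negligible (ler0n R 4) stationary_small_ball.
  by apply: negligibleS => w /= /contrapT.
apply: filterS2 hC1 nodz => w [dX _] nodz t; split; first exact: dX.
by move=> Xt; apply/eqP => X't; apply: nodz; exists t; split.
Qed.

(** The rate [8^-1 ^+ n] makes the Chebyshev bound at distance [2^-1 ^+ n]
    summable. *)
Lemma almost_periods :
  (exists t : nat -> R,
      t n @[n --> \oo] --> +oo /\ `|C (t n)| @[n --> \oo] --> (1 : R)) ->
  exists u : nat -> R, forall n, n%:R <= u n /\ 1 - `|C (u n)| <= 8^-1 ^+ n.
Proof.
move=> [t [toy Ct]].
suff /choice[u hu] : forall n, exists s, n%:R <= s /\ 1 - `|C s| <= 8^-1 ^+ n.
  by exists u.
move=> n.
have e0 : 0 < 8^-1 ^+ n :> R by rewrite exprn_gt0.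
have big : \forall k \near \oo, n%:R <= t k by move/cvgryPge : toy; apply.
have near1 : \forall k \near \oo, `|1 - `|C (t k)| | < 8^-1 ^+ n.
  by move/cvgrPdist_lt : Ct; apply.
have [k [tk Ck]] := filter_ex (filterI big near1).
by exists (t k); split => //; apply: le_trans (ltW Ck); exact: ler_norm.
Qed.

Lemma almost_period_close (s q eps : R) (n : nat) :
  1 - `|C s| <= 8^-1 ^+ n -> eps ^+ 2 = 1 -> eps * C s = `|C s| ->
  (P [set w | 2^-1 ^+ n <= `|X q w - eps * X (q - s) w|]%R <=
    (2 * 2^-1 ^+ n)%:E)%E.
Proof.
move=> Cs eps2 epsC.
have cov : covariance P (X q) (X (q - s)) = (C s)%:E.
  by case: hX => _ _ -> _; rewrite subKr.
have e0 : 0 < 2^-1 ^+ n :> R by rewrite exprn_gt0.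
apply: le_trans (chebyshev_correlation (stationary_standardized q)
  (stationary_standardized (q - s)) cov eps2 e0) _.
rewrite lee_fin epsC.
have -> : 2 * 2^-1 ^+ n = (2^-1 ^+ n) ^- 2 * (2 * 8^-1 ^+ n) :> R.
  have -> : 8^-1 ^+ n = (2^-1 ^+ n) ^+ 3 :> R.
    have -> : 8^-1 = 2^-1 ^+ 3 :> R by field.
    by rewrite -!exprM mulnC.
  by set a := 2^-1 ^+ n in e0 *; field; rewrite gt_eqF.
by rewrite ler_pM2l ?invr_gt0 ?exprn_gt0//; lra.
Qed.

End stationary.

End assembly.

Theorem proposition6 (d : measure_display) (T : measurableType d)
  (R : realType) (P : probability T R) (X : R -> {RV P >-> R}) (C : R -> R)
  (hX : stationary_gaussian_process X C)
  (hC1 : {ae P, forall w : T, class_C1 (fun t : R => X t w)})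
  (hC : exists t : nat -> R,
      t n @[n --> \oo] --> +oo /\ `|C (t n)| @[n --> \oo] --> (1 : R)) :
  completely_predictable P (zero_set (fun t : R => X t)).
Proof.
have ae_simple := stationary_simple_zeros hX hC1.
have small_ball := stationary_small_ball hX.
have [u hu] := almost_periods hC.
split; first split.
- apply: filterS ae_simple => w; exact: zeros_locally_finite.
- apply: sigma_counts_sub_completed => // q r _; apply: sub_sigma_algebra; left.
  exact: measurable_sign_change.
rewrite eqEsubset; split; last first.
  apply: subset_trans (bigcap_inf (i := 0) I) _; apply: completed_sub.
  move=> A /sigma_counts_restrict sA; apply: sub_sigma_algebra; left; exact: sA.
move=> A sA t _; move: A sA; apply: completed_sub.
apply: sigma_counts_sub_completed => // q r qr.
pose N0 := (Num.truncn `|ratr r - t : R|).+1.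
pose eps n : R := if 0 <= C (u n) then 1 else -1.
have eps2 n : eps n ^+ 2 = 1 by rewrite /eps; case: ifP => _; rewrite ?sqrrN expr1n.
have epsC n : eps n * C (u n) = `|C (u n)|.
  rewrite /eps; case: ifPn => [C0|]; first by rewrite mul1r ger0_norm.
  by rewrite -ltNge => C0; rewrite mulN1r ltr0_norm.
have close n q := almost_period_close hX q (hu n).2 (eps2 n) (epsC n).
(* For indices from [N0] on, the shifted window ends before time [t]. *)
apply: completed_ae
  (sign_change_liminf (ler0n R 4) small_ball eps2 close (ratr q) (ratr r) N0).
apply: (@bigcupT_measurable _ (g_sigma_algebraType (_ `|` P.-negligible))) => N.
apply: bigcap_measurable => [|n _]; first by exists N => /=.
apply: (past_sign_change small_ball ae_simple); first by rewrite ltrD2r.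
rewrite lerBlDr -lerBlDl; apply: le_trans (hu _).1.
apply: (@le_trans _ _ N0%:R); last by rewrite ler_nat leq_addl.
exact: le_trans (ler_norm _) (ltW (truncnS_gt _)).
Qed.
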